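(* Let $G=(V,E)$ be a finite graph and let $\mathbf J=(J_e)_{e\in E}$ be ferromagnetic pair interactions on $G$ (i.e. $J_e\in[0,\infty)$ for all $e\in E$). Then for every $k\in\mathbb N$, every $j_1,\dots,j_{2k}\in V$ (not necessarily distinct) and every edge $u_0v_0\in E$, $$(-1)^{k-1}\,\frac{\partial\, u_{2k}(\sigma_{j_1},\dots,\sigma_{j_{2k}})}{\partial J_{u_0v_0}}\;\ge\;0 .$$
   Context: The Ising model on a finite graph $G=(V,E)$ with interactions $\mathbf J=(J_{uv})_{uv\in E}$, $J_{uv}\ge 0$, is the probability measure on $\{-1,+1\}^V$ given by $\mathbb P_G(\sigma)=\exp\big[\sum_{uv\in E}J_{uv}\sigma_u\sigma_v\big]/Z_G$, where $Z_G$ is the normalizing constant; $\langle\cdot\rangle_G$ denotes expectation. For vertices $j_1,\dots,j_m$ (not necessarily distinct) the Ursell function is $$u_m(\sigma_{j_1},\dots,\sigma_{j_m})=\sum_{\mathscr P}(-1)^{|\mathscr P|-1}(|\mathscr P|-1)!\prod_{P\in\mathscr P}\Big\langle\prod_{i\in P}\sigma_{j_i}\Big\rangle_G,$$ the sum being over all set partitions $\mathscr P$ of the index set $\{1,\dots,m\}$ and $|\mathscr P|$ the number of blocks; equivalently $u_m=\partial^m/\partial h_1\cdots\partial h_m\,\ln\langle\exp(\sum_i h_i\sigma_{j_i})\rangle_G\big|_{h=0}$. It is regarded as a function of $\mathbf J$. *)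

(* Defs.v *)
From HB Require Import structures.
From mathcomp Require Import all_boot all_order all_algebra.
From mathcomp Require Import all_classical all_reals all_analysis.
Set Implicit Arguments. Unset Strict Implicit. Unset Printing Implicit Defensive.
Import Order.TTheory GRing.Theory Num.Theory.
Local Open Scope ring_scope.

Section Ising.
Variables (R : realType) (V : finType).

Definition spin (b : bool) : R := if b then 1 else -1.

(* Boltzmann weight of sigma : V -> {-1,+1}; graph given by edge set E,
   each edge a 2-element subset of V; J gives the coupling on each edge.
   \prod_(x in e) spin (sigma x) = sigma_u sigma_v for e = {u,v}. *)
Definition ising_weight (E : {set {set V}}) (J : {set V} -> R)
  (sigma : {ffun V -> bool}) : R :=
  expR (\sum_(e in E) J e * \prod_(x in e) spin (sigma x)).

Definition ising_Z (E : {set {set V}}) (J : {set V} -> R) : R :=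
  \sum_(sigma : {ffun V -> bool}) ising_weight E J sigma.

Definition ising_expect (E : {set {set V}}) (J : {set V} -> R)
  (f : {ffun V -> bool} -> R) : R :=
  (\sum_(sigma : {ffun V -> bool}) f sigma * ising_weight E J sigma)
    / ising_Z E J.

Definition ursell (E : {set {set V}}) (J : {set V} -> R) (m : nat)
  (j : 'I_m -> V) : R :=
  \sum_(P : {set {set 'I_m}} | finset.partition P [set: 'I_m])
    (-1) ^+ (#|P|.-1) * ((#|P|.-1)`!)%:R *
    \prod_(B in P)
      ising_expect E J (fun sigma => \prod_(i in B) spin (sigma (j i))).

Definition Jupd (J : {set V} -> R) (e0 : {set V}) (t : R) : {set V} -> R :=
  fun e => if e == e0 then t else J e.

End Ising.

(* Main.v *)
(** Write a field h through the insertions and substitute h -> ih.  The sign rule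
    says that, after this substitution, the non-constant Taylor coefficients of
    <s_u s_v> are nonpositive, which makes those of d(-ln Z)/dJ_uv nonnegative.
    Expand the pair (s, t) of independent copies of the model in Mayer factors
    exp(J_e (s_e + t_e)) - 1.  They vanish unless the product s t is constant on
    e, so the cluster C of a vertex w where s_w <> t_w carries no field, and
      d<s_u s_v>/dh_w = sum over C containing w and u but not v of
                          a_C (Z_{V\C} / Z_V)^2 <s_v>_{V\C},
    plus the same with u and v exchanged; similarly d<s_v>/dh_w is the sum over
    C containing v, w of a_C (Z_{V\C} / Z_V)^2.  Here a_C >= 0 by Griffiths' first
    inequality.  By induction on the order, the sign rule gives monotonicity in J
    of the coefficients of -ln Z(ih), hence nonnegative coefficients of
    Z_{V\C}(ih) / Z_V(ih), and the two identities yield the next order.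
    Since Ursell functions only involve derivatives that are multilinear in the
    field, power series are replaced by set functions under subset convolution.
    Adding J' >= 0 to an edge multiplies Z by cosh J' + sinh J' <s_u s_v>, so
    monotonicity in J is obtained without differentiating. *)
Require Import Defs.
From HB Require Import structures.
From mathcomp Require Import all_boot all_order all_algebra.
From mathcomp Require Import all_classical all_reals all_analysis.
From mathcomp Require Import ring lra.
(* Restores the finite-set names shadowed by classical_sets. *)
From mathcomp Require Import fintype finset.
Set Implicit Arguments. Unset Strict Implicit. Unset Printing Implicit Defensive.
Import Order.TTheory GRing.Theory Num.Theory.
Local Open Scope ring_scope.

(** * The algebra of set functions *)

(** A set function stands for the polynomial sum_S a_S prod_(i in S) h_i modulo the relations h_i^2
    = 0; [samul] below is the product of such truncated power series. *)
Definition setalg (R : Type) (I : finType) : Type := {ffun {set I} -> R}.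

Section SetAlgebra.
Variables (R : comNzRingType) (I : finType).
Local Notation A := (setalg R I).
Implicit Types (a b c : A) (S T U : {set I}).

HB.instance Definition _ := GRing.Zmodule.on A.

Definition coef S a : R := (a : {ffun {set I} -> R}) S.
Definition setalg_of (f : {set I} -> R) : A := finfun f.

Lemma coef_of f S : coef S (setalg_of f) = f S. Proof. by rewrite /coef ffunE. Qed.

Lemma setalgP a b : (forall S, coef S a = coef S b) -> a = b.
Proof. by move=> h; apply/ffunP. Qed.

Lemma coefD S a b : coef S (a + b) = coef S a + coef S b.
Proof. by rewrite /coef ffunE. Qed.
Lemma coefN S a : coef S (- a) = - coef S a.
Proof. by rewrite /coef ffunE. Qed.
Lemma coefB S a b : coef S (a - b) = coef S a - coef S b.
Proof. by rewrite coefD coefN. Qed.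
Lemma coef0 S : coef S 0 = 0. Proof. by rewrite /coef ffunE. Qed.

Lemma coef_sum S (K : Type) (r : seq K) (P : pred K) (F : K -> A) :
  coef S (\sum_(k <- r | P k) F k) = \sum_(k <- r | P k) coef S (F k).
Proof.
elim/big_rec2: _ => [|k x y _ <-]; first exact: coef0.
by rewrite coefD.
Qed.

Definition samul a b : A :=
  setalg_of (fun S => \sum_(T : {set I} | T \subset S) coef T a * coef (S :\: T) b).
Definition sacst (x : R) : A := setalg_of (fun S => if S == set0 then x else 0).

Lemma setDKs S T : T \subset S -> S :\: (S :\: T) = T.
Proof. by move=> h; rewrite setDDr setDv set0U; apply/setIidPr. Qed.

Lemma samulC : commutative samul.
Proof.
move=> a b; apply: setalgP => S; rewrite !coef_of.
rewrite (reindex_onto (fun T => S :\: T) (fun T => S :\: T)) /=; last first.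
  by move=> T; exact: setDKs.
apply: eq_big => [T|T /andP[_ /eqP h]]; last by rewrite h mulrC.
rewrite subsetDl /=; apply/eqP/idP => [<-|]; [exact: subsetDl | exact: setDKs].
Qed.

Lemma samulA : associative samul.
Proof.
move=> a b c; apply: setalgP => S; rewrite !coef_of.
under [RHS]eq_bigr => T _ do rewrite coef_of mulr_suml.
under [LHS]eq_bigr => T _ do rewrite coef_of mulr_sumr.
rewrite [RHS](exchange_big_dep (fun U => U \subset S)) /=; last first.
  by move=> T U TS /subset_trans; apply.
apply: eq_bigr => U US.
rewrite [RHS](reindex_onto (fun W => U :|: W) (fun T => T :\: U)) /=; last first.
  by move=> T /andP[_ UT]; rewrite -{1}(setIidPr UT) setID.
apply: eq_big => [W|W WS].
  rewrite subUset US subsetUl andbT /= setDUl setDv set0U subsetD.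
  by congr (_ && _); apply/setDidPl/eqP.
move: (WS); rewrite subsetD => /andP[_ dWU].
by rewrite setDUl setDv set0U setDDl (setDidPl dWU) mulrA.
Qed.

Lemma samul1 : left_id (sacst 1) samul.
Proof.
move=> a; apply: setalgP => S; rewrite coef_of (bigD1 set0) ?sub0set //=.
rewrite coef_of eqxx mul1r setD0 big1 ?addr0 // => T /andP[_ /negPf h].
by rewrite coef_of h mul0r.
Qed.

Lemma samulDl : left_distributive samul +%R.
Proof.
move=> a b c; apply: setalgP => S; rewrite coefD !coef_of -big_split /=.
by apply: eq_bigr => T _; rewrite coefD mulrDl.
Qed.

Lemma sacst1_neq0 : sacst 1 != 0 :> A.
Proof.
apply/eqP => /(congr1 (coef set0)); rewrite coef_of eqxx coef0.
by apply/eqP; rewrite oner_eq0.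
Qed.

HB.instance Definition _ := GRing.Zmodule_isComNzRing.Build A
  samulA samulC samul1 samulDl sacst1_neq0.

Lemma coefM S a b :
  coef S (a * b) = \sum_(T : {set I} | T \subset S) coef T a * coef (S :\: T) b.
Proof. by rewrite [LHS]coef_of. Qed.

Lemma coef_cst x S : coef S (sacst x) = if S == set0 then x else 0.
Proof. exact: coef_of. Qed.

Lemma coef_cstM x S a : coef S (sacst x * a) = x * coef S a.
Proof.
rewrite coefM (bigD1 set0) ?sub0set //=.
rewrite coef_cst eqxx setD0 big1 ?addr0 // => T /andP[_ /negPf h].
by rewrite coef_cst h mul0r.
Qed.

Lemma coef0M a b : coef set0 (a * b) = coef set0 a * coef set0 b.
Proof.
rewrite coefM (bigD1 set0) ?sub0set //= setD0 big1 ?addr0 // => T.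
by rewrite subset0 => /andP[->].
Qed.

Lemma sacst1 : sacst 1 = 1. Proof. by []. Qed.
Definition theta (i : I) : A := setalg_of (fun S => (S == [set i])%:R).
(** The Euler operator h_i d/dh_i, with [theta i] the variable h_i. Unlike d/dh_i it respects h_i^2
    = 0, hence is a derivation. *)
Definition sader (i : I) a : A := setalg_of (fun S => if i \in S then coef S a else 0).

Lemma coef_thetaM i S a :
  coef S (theta i * a) = if i \in S then coef (S :\ i) a else 0.
Proof.
rewrite coefM; case: ifP => iS.
  rewrite (bigD1 [set i]) ?sub1set //= coef_of eqxx mul1r big1 ?addr0 // => T.
  by case/andP=> _ /negPf h; rewrite coef_of h mul0r.
rewrite big1 // => T; rewrite coef_of; case: eqP => [->|]; last by rewrite mul0r.
by rewrite sub1set iS.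
Qed.

Lemma coef_sader i S a : coef S (sader i a) = if i \in S then coef S a else 0.
Proof. exact: coef_of. Qed.

Lemma sader_cst i x : sader i (sacst x) = 0.
Proof.
apply: setalgP => S; rewrite coef_sader coef_cst coef0.
by case: (S =P set0) => [->|_]; rewrite ?inE ?if_same.
Qed.

Lemma saderD i a b : sader i (a + b) = sader i a + sader i b.
Proof.
by apply: setalgP => S; rewrite !(coefD, coef_sader); case: ifP; rewrite ?addr0.
Qed.

Lemma saderM i a b : sader i (a * b) = sader i a * b + a * sader i b.
Proof.
apply: setalgP => S; rewrite coef_sader coefD !coefM -big_split /=.
case: ifP => iS; last first.
  rewrite big1 // => T TS; rewrite !coef_sader inE iS andbF mulr0 addr0.
  by rewrite ifN ?mul0r //; apply: contraFN iS => /(subsetP TS).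
apply: eq_bigr => T TS; rewrite !coef_sader inE iS andbT.
by case: ifP => _; rewrite ?mulr0 ?mul0r ?addr0 ?add0r.
Qed.

Lemma nilp_exp a k : coef set0 a = 0 ->
  forall S, (#|S| < k)%N -> coef S (a ^+ k) = 0.
Proof.
move=> a0; elim: k => // k IH S; rewrite ltnS => Sk.
rewrite exprS coefM big1 // => T TS.
case: (T =P set0) => [->|/eqP T0]; first by rewrite a0 mul0r.
rewrite IH ?mulr0 //; apply: leq_trans Sk; rewrite cardsDS // ltn_subrL.
by rewrite card_gt0 T0 (leq_trans _ (subset_leq_card TS)) // card_gt0.
Qed.
End SetAlgebra.

(** * Inverses of set functions *)

Section SetAlgebraInverse.
Variables (F : fieldType) (I : finType).
Local Notation A := (setalg F I).
Implicit Types (a b c : A) (S T U : {set I}).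

(** Geometric series in 1 - a / a_0, finite because an element without constant term is
    nilpotent. *)
Definition sainv a : A := sacst I (coef set0 a)^-1 *
  \sum_(k < #|I|.+1) (1 - sacst I (coef set0 a)^-1 * a) ^+ k.

Lemma sainvP a : coef set0 a != 0 -> a * sainv a = 1.
Proof.
move=> a0; rewrite /sainv mulrA (mulrC a); set n := _ * a.
have := subrX1 (1 - n) #|I|.+1.
have -> : (1 - n) ^+ #|I|.+1 = 0.
  apply: setalgP => S; rewrite nilp_exp ?coef0 ?ltnS ?max_card //.
  by rewrite coefB coef_cstM -sacst1 coef_cst eqxx mulVf // subrr.
rewrite sub0r addrAC subrr add0r mulNr => /oppr_inj <-.
by [].
Qed.

Lemma saregI a b c : coef set0 a != 0 -> a * b = a * c -> b = c.
Proof.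
move=> /sainvP h e; rewrite -[b]mul1r -[c]mul1r -h.
by rewrite (mulrC a) -!mulrA e.
Qed.
End SetAlgebraInverse.

(** * Moments and cumulants *)

Section MomentCumulant.
Variables (R : comNzRingType) (I : finType) (m : {set I} -> R).
Hypothesis m0 : m set0 = 1.
Implicit Types (S Q B : {set I}) (P : {set {set I}}).

(** The Moebius function of the partition lattice between its extreme elements. *)
Definition mobius n : R := (-1) ^+ n.-1 * (n.-1`!)%:R.
Definition cumulant S : R :=
  \sum_(P | partition P S) mobius #|P| * \prod_(B in P) m B.

Lemma mobius_rec n : (0 < n)%N ->
  mobius n + mobius n.-1 *+ n.-1 = (n == 1)%:R.
Proof.
case: n => [//|[|n]] _; rewrite /mobius /=; first by rewrite mulr0n addr0 mulr1.
rewrite exprS factS natrM -mulr_natr; by ring.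
Qed.

Lemma card_partition_notin P S i : partition P S -> i \in S ->
  #|[set Q in P | i \notin Q]| = #|P|.-1.
Proof.
move=> PS iS; have tr := partition_trivIset PS.
have iP : i \in cover P by rewrite (cover_partition PS).
have -> : [set Q in P | i \notin Q] = P :\ pblock P i.
  apply/setP => Q; rewrite !inE andbC; case: (boolP (Q \in P)) => QP; rewrite ?andbF //.
  rewrite !andbT; congr (~~ _).
  apply/idP/eqP => [iQ|->]; last by rewrite mem_pblock.
  by rewrite (def_pblock tr QP iQ).
by rewrite (cardsD1 (pblock P i) P) pblock_mem.
Qed.

Lemma cumulant_setD S Q : Q \subset S -> Q != set0 ->
  m Q * cumulant (S :\: Q) =
  \sum_(P | partition P S && (Q \in P)) mobius #|P|.-1 * \prod_(B in P) m B.
Proof.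
move=> QS Q0; rewrite [RHS](reindex_onto (fun P => Q |: P) (fun P => P :\ Q)) /=;
  last by move=> P /andP[_]; exact: setD1K.
rewrite mulr_sumr; apply: eq_big => [P|P PS].
  apply/idP/idP => [PS|/andP[/andP[PS _] /eqP h]].
    have QP : Q \notin P.
      apply: contra Q0 => /(partitionS PS); rewrite subsetD => /andP[_].
      by rewrite -setI_eq0 setIid.
    rewrite setU11 setU1K // eqxx !andbT -(setID S Q) (setIidPr QS).
    by apply: partitionU1 => //; rewrite disjoint_sym disjoints_subset subsetDr.
  by have := partitionD1 PS (setU11 Q P); rewrite h.
have QP : Q \notin P.
  apply: contra Q0 => /(partitionS PS); rewrite subsetD => /andP[_].
  by rewrite -setI_eq0 setIid.
by rewrite cardsU1 QP big_setU1 //=; ring.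
Qed.

(** This is Z' = Z (ln Z)' in coefficients. After exchanging sums, a partition P of S has weight
    [mobius #|P|] plus one term [mobius #|P|.-1] for each of its #|P| - 1 blocks avoiding i; by
    [mobius_rec] only P = {S} survives. *)
Lemma moment_cumulant S i : i \in S ->
  m S = \sum_(Q : {set I} | (Q \subset S) && (i \notin Q))
          m Q * cumulant (S :\: Q).
Proof.
move=> iS; rewrite (bigD1 set0) /=; last by rewrite sub0set inE.
rewrite m0 mul1r setD0.
under eq_bigr => Q /andP[/andP[QS _] Q0] do rewrite (cumulant_setD QS Q0).
rewrite (exchange_big_dep (fun P => partition P S)) /=; last first.
  by move=> Q P _ /andP[].
rewrite {1}/cumulant -big_split /=.
transitivity (\sum_(P | partition P S) (#|P| == 1)%:R * \prod_(B in P) m B).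
  rewrite (bigD1 [set S]) /=; last first.
    rewrite /partition /cover big_set1 eqxx trivIset1 inE /=.
    by apply: contraTN iS => /eqP <-; rewrite inE.
  rewrite cards1 big_set1 mul1r big1 ?addr0 // => P /andP[PS PnS].
  case: eqP => [/eqP/cards1P[B PB]|_]; last by rewrite mul0r.
  by case/eqP: PnS; rewrite PB -(cover_partition PS) PB /cover big_set1.
apply: eq_bigr => P PS.
rewrite [X in _ + X](eq_bigl (fun Q => Q \in [set Q in P | i \notin Q])); last first.
  move=> Q; rewrite PS inE /=; case: (boolP (Q \in P)) => QP; rewrite ?andbF //.
  by rewrite (partitionS PS QP) (partition_neq0 PS QP) /= !andbT.
rewrite sumr_const (card_partition_notin PS iS) -mobius_rec.
  by rewrite mulrDl mulrnAl.
rewrite card_gt0; apply: contraTneq PS => ->.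
rewrite /partition /cover big_set0 eq_sym; apply/nandP; left.
by apply/set0Pn; exists i.
Qed.
End MomentCumulant.

(** * Cluster expansion *)

Section ProductExpansion.
Variables (R : comNzRingType) (K : finType).

Lemma prodrD_subsets (A : {set K}) (F G : K -> R) :
  \prod_(k in A) (F k + G k) =
  \sum_(B : {set K} | B \subset A)
    (\prod_(k in B) F k) * (\prod_(k in A :\: B) G k).
Proof.
pose F' k := if k \in A then F k else 0.
pose G' k := if k \in A then G k else 1.
transitivity (\prod_k (F' k + G' k)).
  rewrite big_mkcond; apply: eq_bigr => k _; rewrite /F' /G'.
  by case: ifP => // _; rewrite add0r.
rewrite bigA_distr (bigID (fun B : {set K} => B \subset A)) /= [X in _ + X]big1.
  rewrite addr0; apply: eq_big => // B BA.
  rewrite (bigID (mem B)) /=; congr (_ * _).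
    by apply: eq_bigr => k kB; rewrite kB /F' (subsetP BA).
  rewrite [RHS]big_mkcond [LHS]big_mkcond /=.
  by apply: eq_bigr => k _; rewrite inE /G'; case: (k \in B) => //=.
move=> B /subsetPn[k kB kA].
by rewrite (bigD1 k) //= kB /F' (negPf kA) mul0r.
Qed.

Lemma prodr1D_subsets (A : {set K}) (F : K -> R) :
  \prod_(k in A) (1 + F k) = \sum_(B : {set K} | B \subset A) \prod_(k in B) F k.
Proof.
under eq_bigr => k _ do rewrite addrC.
rewrite prodrD_subsets; apply: eq_bigr => B _.
by rewrite (big1 _ (mem (A :\: B))) ?mulr1.
Qed.
End ProductExpansion.

Section Cluster.
Variables (V : finType) (r : V).
Implicit Types (w : {set {set V}}) (A C e : {set V}).

Definition isolated w A := [forall e in w, (e \subset A) || [disjoint e & A]].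

Lemma isolatedP w A : reflect
  (forall e, e \in w -> (e \subset A) || [disjoint e & A]) (isolated w A).
Proof. exact: 'forall_implyP. Qed.

(* The connected component of r in the graph w. *)
Definition cluster w : {set V} :=
  \bigcap_(A : {set V} | (r \in A) && isolated w A) A.

Lemma cluster_root w : r \in cluster w.
Proof. by apply/bigcapP => A /andP[]. Qed.

Lemma cluster_min w A : r \in A -> isolated w A -> cluster w \subset A.
Proof. by move=> rA iA; apply: bigcap_inf; rewrite rA iA. Qed.

Lemma cluster_isolated w : isolated w (cluster w).
Proof.
apply/isolatedP => e ew; case: (boolP [disjoint e & cluster w]); rewrite ?orbT //.
rewrite orbF => /pred0Pn[x /andP[xe xc]].
apply/bigcapsP => A /andP[rA /isolatedP iA].
case/orP: (iA _ ew) => // /pred0P /(_ x) /=.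
by rewrite [x \in e]xe; move/bigcapP: xc => /(_ A) -> //; rewrite rA; apply/isolatedP.
Qed.

Lemma isolated_sub w w' A : w' \subset w -> isolated w A -> isolated w' A.
Proof. by move=> /subsetP s /isolatedP h; apply/isolatedP => e /s /h. Qed.

Lemma cluster_mono w w' : w' \subset w -> cluster w' \subset cluster w.
Proof.
move=> s; apply: cluster_min (cluster_root _) _.
exact: isolated_sub s (cluster_isolated _).
Qed.

Variable E : {set {set V}}.
Definition edges_in C := [set e in E | e \subset C].
Definition edges_off C := [set e in E | [disjoint e & C]].

Lemma cluster_inner w C : cluster w = C ->
  cluster [set e in w | e \subset C] = C.
Proof.
set w1 := [set e in w | _] => cC.
have s1 : w1 \subset w by apply/subsetP => e; rewrite inE => /andP[].
have s2 : cluster w1 \subset C by rewrite -cC; exact: cluster_mono.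
apply/eqP; rewrite eqEsubset s2 /= -{1}cC.
apply: cluster_min (cluster_root _) _; apply/isolatedP => e ew.
have /isolatedP/(_ e ew) := cluster_isolated w; rewrite cC.
case/orP => [eC|dC].
  by have /isolatedP := cluster_isolated w1; apply; rewrite inE ew.
by rewrite (disjointWr s2 dC) orbT.
Qed.

Lemma clusterU w1 w2 C : cluster w1 = C -> w2 \subset edges_off C ->
  cluster (w1 :|: w2) = C.
Proof.
move=> c1 /subsetP s2; apply/eqP; rewrite eqEsubset -{2}c1.
rewrite cluster_mono ?subsetUl // andbT.
apply: cluster_min; first by rewrite -c1 cluster_root.
apply/isolatedP => e; rewrite inE => /orP[e1|/s2]; last first.
  by rewrite inE => /andP[_ ->]; rewrite orbT.
by have /isolatedP/(_ e e1) := cluster_isolated w1; rewrite c1.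
Qed.

Hypothesis E0 : set0 \notin E.

Lemma edges_in_off C : [disjoint edges_in C & edges_off C].
Proof.
apply/pred0P => e /=; rewrite !inE; apply/negP => /andP[/andP[eE eC] /andP[_]].
case: (set_0Vmem e) => [e0|[x xe]]; first by move: E0; rewrite -e0 eE.
by move/pred0P/(_ x) => /=; rewrite xe (subsetP eC).
Qed.

(** No edge of a graph with cluster C crosses the boundary of C: the edges inside C make C
    connected, those off C are arbitrary, and the sum over the latter is again a product. *)
Lemma cluster_sum (R : comNzRingType) (G : {set V} -> R) C :
  \sum_(w : {set {set V}} | (w \subset E) && (cluster w == C))
     \prod_(e in w) G e =
  (\sum_(w : {set {set V}} | (w \subset edges_in C) && (cluster w == C))
     \prod_(e in w) G e) * \prod_(e in edges_off C) (1 + G e).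
Proof.
have inE' : edges_in C \subset E by apply/subsetP => e; rewrite inE => /andP[].
have offE : edges_off C \subset E by apply/subsetP => e; rewrite inE => /andP[].
rewrite prodr1D_subsets big_distrlr /= pair_big_dep /=.
rewrite (reindex_onto (fun p : {set {set V}} * {set {set V}} => p.1 :|: p.2)
  (fun w => (w :&: edges_in C, w :&: edges_off C))) /=.
  apply: eq_big => [[w1 w2]|[w1 w2] /= /andP[_ /eqP[e1 e2]]] /=.
    apply/andP/andP => [[/andP[_ /eqP c] /eqP[e1 e2]]|[/andP[s1 /eqP c] s2]].
      have s1 : w1 \subset edges_in C by rewrite -e1 subsetIr.
      have s2 : w2 \subset edges_off C by rewrite -e2 subsetIr.
      split=> //; rewrite s1 /= -(cluster_inner c); apply/eqP; congr cluster.
      apply/setP => e; rewrite !inE.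
      case: (boolP (e \in w1)) => /= [e1'|_].
        by move: (subsetP s1 _ e1'); rewrite inE => /andP[_ ->].
      apply/esym/negP => /andP[e2' eC]; have := subsetP s2 _ e2'.
      move=> eo; have /pred0P/(_ e) := edges_in_off C.
      by rewrite /= eo inE eC; move: eo; rewrite inE => /andP[->].
    have d12 : (w1 :&: edges_off C = set0) /\ (w2 :&: edges_in C = set0).
      split; apply/eqP; rewrite setI_eq0.
        exact: disjointWl s1 (edges_in_off C).
      by rewrite disjoint_sym; apply: disjointWr s2 (edges_in_off C).
    rewrite (clusterU c s2) eqxx andbT subUset.
    rewrite (subset_trans s1) // (subset_trans s2) //.
    rewrite !setIUl d12.1 d12.2 setU0 set0U.
    by rewrite (setIidPl s1) (setIidPl s2).
  have d12 : [disjoint w1 & w2].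
    rewrite -e1 -e2; apply: disjointWl (subsetIr _ _) _.
    exact: disjointWr (subsetIr _ _) (edges_in_off C).
  by rewrite -(bigU _ _ _ d12) /=; apply: eq_bigl => e; rewrite !inE.
move=> w /andP[wE /eqP c] /=; rewrite -setIUr; apply/setIidPl/subsetP => e ew.
rewrite !inE (subsetP wE _ ew) /=.
by have /isolatedP/(_ e ew) := cluster_isolated w; rewrite c.
Qed.

Lemma mayer_cluster (R : comNzRingType) (G : {set V} -> R) :
  \prod_(e in E) (1 + G e) = \sum_(C : {set V})
    (\sum_(w : {set {set V}} | (w \subset edges_in C) && (cluster w == C))
      \prod_(e in w) G e) * \prod_(e in edges_off C) (1 + G e).
Proof.
rewrite prodr1D_subsets (partition_big cluster xpredT) //=.
by apply: eq_bigr => C _; rewrite cluster_sum.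
Qed.
End Cluster.

(** [mix a b] takes from a what f sees and from b what g sees. Exchanging these parts is an
    involution on pairs that brings f and g to the same argument. *)
Lemma sum_mix (R : comNzRingType) (W : finType) (mix : W -> W -> W)
    (f g : W -> R) :
  (forall a b, mix (mix a b) (mix b a) = a) ->
  (forall a b, f (mix a b) = f a) -> (forall a b, g (mix a b) = g b) ->
  (\sum_a f a) * (\sum_a g a) = #|W|%:R * \sum_a f a * g a.
Proof.
move=> mixK fE gE; rewrite big_distrlr /= pair_big /=.
transitivity (\sum_(p : W * W) f (mix p.1 p.2) * g (mix p.1 p.2)).
  by apply: eq_bigr => p _; rewrite fE gE.
rewrite (reindex_onto (fun p => (mix p.1 p.2, mix p.2 p.1))
  (fun p => (mix p.1 p.2, mix p.2 p.1))) /=; last first.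
  by case=> a b _ /=; rewrite !mixK.
under eq_bigl => p do rewrite !mixK -surjective_pairing eqxx.
under eq_bigr => p _ do rewrite mixK.
rewrite -(pair_big xpredT xpredT (fun a b => f a * g a)) /= mulr_sumr.
by apply: eq_bigr => a _; rewrite sumr_const mulr_natl.
Qed.

(** * The duplicated Ising model *)

Section Characters.
Variables (R : realType) (V : finType).
Local Notation config := {ffun V -> bool}.
Implicit Types (s t : config) (X Y C e : {set V}).

Definition chi X s : R := \prod_(x in X) spin R (s x).

Lemma chi1 x s : chi [set x] s = spin R (s x).
Proof. by rewrite /chi big_set1. Qed.

Lemma chi0 s : chi set0 s = 1.
Proof. by rewrite /chi big_set0. Qed.

Lemma chi_pm X s : chi X s = 1 \/ chi X s = -1.
Proof.
rewrite /chi; elim/big_rec: _ => [|x y _ [->|->]]; first by left.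
  by rewrite mulr1; case: (s x); [left|right].
by rewrite mulrN1; case: (s x); [right|left; rewrite /= opprK].
Qed.

Lemma chi_split X C s : chi X s = chi (X :&: C) s * chi (X :\: C) s.
Proof. by rewrite /chi -big_setID. Qed.

Lemma chiM X Y s : chi X s * chi Y s = chi ((X :\: Y) :|: (Y :\: X)) s.
Proof.
rewrite (chi_split X Y) (chi_split Y X) (setIC Y X).
have -> : chi ((X :\: Y) :|: (Y :\: X)) s = chi (X :\: Y) s * chi (Y :\: X) s.
  have d : [disjoint X :\: Y & Y :\: X].
    by rewrite -setI_eq0; apply/eqP/setP => x;
    rewrite !inE; case: (x \in X); rewrite ?andbF.
  rewrite /chi -(bigU _ _ _ d) /=; apply: eq_bigl => x; by rewrite !inE.
case: (chi_pm (X :&: Y) s) => ->; ring.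
Qed.

Definition flip s : config := [ffun x => ~~ s x].

Lemma flipK : involutive flip.
Proof. by move=> s; apply/ffunP => x; rewrite !ffunE negbK. Qed.

Lemma spinN b : spin R (~~ b) = - spin R b.
Proof. by case: b; rewrite /= ?opprK. Qed.

Lemma chi_flip X s : chi X (flip s) = (-1) ^+ #|X| * chi X s.
Proof.
rewrite /chi -prodr_const -big_split /=; apply: eq_bigr => x _.
by rewrite ffunE spinN mulN1r.
Qed.

Lemma chi_sum_ge0 X : 0 <= \sum_s chi X s.
Proof.
case: (set_0Vmem X) => [->|[x xX]].
  by apply: sumr_ge0 => s _; rewrite chi0 ler01.
pose fl s : config := [ffun y => if y == x then ~~ s y else s y].
have flK : involutive fl.
  by move=> s; apply/ffunP => y; rewrite !ffunE; case: eqP; rewrite ?negbK.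
have e : \sum_s chi X s = - \sum_s chi X s.
  rewrite {1}(reindex_inj (inv_inj flK)) -sumrN; apply: eq_bigr => s _.
  rewrite /chi !(bigD1 x xX) /= !ffunE eqxx spinN mulNr; congr (- (_ * _)).
  by apply: eq_bigr => y /andP[_ /negPf yx]; rewrite ffunE yx.
suff -> : \sum_s chi X s = 0 by [].
by apply/eqP; rewrite -[_ == 0](mulrn_eq0 _ 2) mulr2n {1}e addNr.
Qed.

(** Griffiths' first inequality: expanding the product gives characters with nonnegative
    coefficients, and a character has nonnegative sum over all configurations. *)
Lemma griffiths1 (L : seq {set V}) (p q : {set V} -> R) Y :
  (forall e, e \in L -> 0 <= p e) -> (forall e, e \in L -> 0 <= q e) ->
  0 <= \sum_s chi Y s * \prod_(e <- L) (p e + q e * chi e s).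
Proof.
elim: L Y => [|e L IH] Y p0 q0.
  by under eq_bigr => s _ do rewrite big_nil mulr1; exact: chi_sum_ge0.
have pL e' : e' \in L -> 0 <= p e' by move=> h; apply: p0; rewrite inE h orbT.
have qL e' : e' \in L -> 0 <= q e' by move=> h; apply: q0; rewrite inE h orbT.
under eq_bigr => s _ do rewrite big_cons mulrDl mulrDr.
rewrite big_split /=; apply: addr_ge0.
  under eq_bigr => s _ do rewrite mulrCA.
  by rewrite -mulr_sumr mulr_ge0 ?IH ?p0 ?mem_head.
under eq_bigr => s _ do rewrite -mulrA mulrCA (mulrA (chi Y s)) chiM.
by rewrite -mulr_sumr mulr_ge0 ?IH ?q0 ?mem_head.
Qed.

Lemma expRM_pm (k c : R) : c = 1 \/ c = -1 ->
  expR (k * c) = (expR k + expR (- k)) / 2 + (expR k - expR (- k)) / 2 * c.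
Proof. by case=> ->; rewrite ?mulrN1 ?mulr1; field. Qed.

Lemma cosh_ge1 (k : R) : 1 <= (expR k + expR (- k)) / 2.
Proof. by have := expR_ge1Dx k; have := expR_ge1Dx (- k); lra. Qed.

Lemma sinh_ge0 (k : R) : 0 <= k -> 0 <= (expR k - expR (- k)) / 2.
Proof.
by move=> k0; rewrite divr_ge0 // subr_ge0 ler_expR; lra.
Qed.

Definition mix C s t : config := [ffun x => if x \in C then s x else t x].

Lemma mixK C s t : mix C (mix C s t) (mix C t s) = s.
Proof. by apply/ffunP => x; rewrite !ffunE; case: (x \in C). Qed.

Lemma chi_mixl C X s t : X \subset C -> chi X (mix C s t) = chi X s.
Proof.
by move=> h; rewrite /chi; apply: eq_bigr => x xX; rewrite ffunE (subsetP h).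
Qed.

Lemma chi_mixr C X s t : [disjoint X & C] -> chi X (mix C s t) = chi X t.
Proof.
move=> d; rewrite /chi; apply: eq_bigr => x xX; rewrite ffunE ifN //.
by apply: contraL d => xC; apply/pred0Pn; exists x; rewrite /= xX.
Qed.

End Characters.

(** * Cluster expansion of truncated correlations *)

Section Model.
Variables (R : realType) (V I : finType) (j : I -> V) (E : {set {set V}}).
Local Notation config := {ffun V -> bool}.
Local Notation A := (setalg R I).
Implicit Types (s t : config) (X Y C e : {set V}) (S T : {set I}).
Implicit Types (J : {set V} -> R) (f g : config -> R).

Definition insertion S s : R := \prod_(i in S) spin R (s (j i)).

(* The coefficient at S of the partition function with observable f and field
   sum_(i in I) h_i s_(j i), as a multilinear truncated power series in h. *)
Definition zfun J f : A :=
  setalg_of (fun S => \sum_s f s * insertion S s * ising_weight E J s).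

(* [off C] and [rho C] together describe the model on V \ C: the vertices of C
   remain as free spins without field and only contribute a constant factor. *)
Definition off C J e : R := if [disjoint e & C] then J e else 0.
Definition avoids C S := [forall i in S, j i \notin C].
Definition rho C (a : A) : A :=
  setalg_of (fun S => if avoids C S then coef S a else 0).

(** Both copies feel the same field, which therefore couples to s + t; an insertion where s and t
    are opposite vanishes. *)
Definition pair_insertion S s t : R :=
  \prod_(i in S) (spin R (s (j i)) + spin R (t (j i))).

Lemma coef_zfunM J f g S : coef S (zfun J f * zfun J g) =
  \sum_(p : config * config) f p.1 * g p.2 * pair_insertion S p.1 p.2 *
    (ising_weight E J p.1 * ising_weight E J p.2).
Proof.
rewrite coefM.
under eq_bigr => T _ do rewrite !coef_of big_distrlr /= pair_big.
rewrite exchange_big /=; apply: eq_bigr => p _.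
rewrite /pair_insertion prodrD_subsets mulr_sumr mulr_suml.
by apply: eq_bigr => T _; rewrite /insertion; ring.
Qed.

(* The exponent is J_e s_e (1 + s_e t_e), so this vanishes unless the product
   s t of the two copies is constant on the edge e. *)
Definition mayer J s t e : R := expR (J e * (chi R e s + chi R e t)) - 1.

Lemma ising_weightM J s t : ising_weight E J s * ising_weight E J t =
  \prod_(e in E) (1 + mayer J s t e).
Proof.
rewrite /ising_weight -expRD -big_split /= expR_sum.
by apply: eq_bigr => e _; rewrite /mayer [RHS]addrC subrK mulrDr.
Qed.

Lemma mayer_off C J s t : \prod_(e in edges_off E C) (1 + mayer J s t e) =
  ising_weight E (off C J) s * ising_weight E (off C J) t.
Proof.
rewrite ising_weightM [RHS](bigID (fun e => [disjoint e & C])) /=.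
rewrite [X in _ * X]big1 ?mulr1; last first.
  by move=> e /andP[_ /negPf h]; rewrite /mayer /off h mul0r expR0 subrr addr0.
apply: eq_big => [e|e]; rewrite inE //.
by case/andP=> _ h; rewrite /mayer /off h.
Qed.

Hypothesis hE : forall e, e \in E -> #|e| = 2%N.

Lemma edges_neq0 : set0 \notin E.
Proof. by apply/negP => /hE; rewrite cards0. Qed.

(** A nonzero s_e + t_e forces s_e t_e = 1, so on a two-vertex edge the copies disagree at both ends
    or at neither. *)
Lemma mayer_isolated J s t e : e \in E -> mayer J s t e != 0 ->
  (e \subset [set x | s x != t x]) || [disjoint e & [set x | s x != t x]].
Proof.
move=> /hE/eqP/cards2P[x [y [xy ->]]] h; set D := [set x | _].
have: chi R [set x; y] s + chi R [set x; y] t != 0.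
  by apply: contraNneq h => h0; rewrite /mayer h0 mulr0 expR0 subrr.
rewrite /chi !big_setU1 ?inE //= !big_set1 => {h}.
rewrite disjoints_subset !subUset !sub1set !inE.
case: (s x) (s y) (t x) (t y) => [] [] [] [] //=;
  by rewrite ?mulr1 ?mul1r ?mulrN1 ?opprK ?subrr ?addNr ?eqxx.
Qed.

Lemma cluster_opposite J r s t (w : {set {set V}}) : w \subset E ->
  spin R (s r) - spin R (t r) != 0 -> \prod_(e in w) mayer J s t e != 0 ->
  cluster r w \subset [set x | s x != t x].
Proof.
move=> wE sr wn0; apply: cluster_min.
  by rewrite inE; apply: contraNneq sr => ->; rewrite subrr.
apply/isolatedP => e ew; apply: (@mayer_isolated J) (subsetP wE _ ew) _.
by move/prodf_neq0: wn0; apply.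
Qed.

Section KeyIdentity.
Variables (J : {set V} -> R) (r : V) (X : {set V}).
Hypothesis hJ : forall e, e \in E -> 0 <= J e.

(** For a fixed cluster C of r the summand splits into a factor read off on C and one read off
    outside C. The factor s_r - t_r comes from the truncation and makes the copies opposite on all
    of C. *)
Definition inner_sum C (p : config * config) : R :=
  chi R (X :&: C) p.1 * (spin R (p.1 r) - spin R (p.2 r)) *
  \sum_(w : {set {set V}} | (w \subset edges_in E C) && (cluster r w == C))
    \prod_(e in w) mayer J p.1 p.2 e.
Definition outer_sum C S (p : config * config) : R :=
  chi R (X :\: C) p.1 * pair_insertion S p.1 p.2 *
  \prod_(e in edges_off E C) (1 + mayer J p.1 p.2 e).
(** Normalised by the number of pairs because inner and outer factors are each summed over all pairs
    of configurations. *)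
Definition cluster_coef C : R :=
  #|{: config * config}|%:R^-1 * \sum_p inner_sum C p.

(** Substitute t = s u by the involution [tw]. For fixed u, s_r - t_r becomes s_r (1 - u_r), and the
    Mayer factor becomes exp(k_e s_e) - 1 = (cosh k_e - 1) + s_e sinh k_e with k_e = J_e (1 + u_e)
    >= 0, so Griffiths' inequality applies to the sum over s. *)
Lemma cluster_coef_ge0 C : 0 <= cluster_coef C.
Proof.
rewrite mulr_ge0 ?invr_ge0 ?ler0n //.
under eq_bigr => p _ do rewrite /inner_sum mulr_sumr.
rewrite exchange_big /=; apply: sumr_ge0 => w /andP[wC _].
have wE : {subset w <= E}.
  by move=> e /(subsetP wC); rewrite inE => /andP[].
rewrite -(pair_big xpredT xpredT (fun s t => chi R (X :&: C) s *
  (spin R (s r) - spin R (t r)) * \prod_(e in w) mayer J s t e)) /=.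
pose tw s (u : config) : config := [ffun x => s x == u x].
have twK s : involutive (tw s).
  by move=> u; apply/ffunP => x; rewrite !ffunE; case: (s x); case: (u x).
have spin_tw s u x : spin R (tw s u x) = spin R (s x) * spin R (u x).
  by rewrite ffunE; case: (s x); case: (u x); rewrite /= ?mulr1 ?mul1r ?mulrNN ?mulr1.
have chi_tw s u e : chi R e (tw s u) = chi R e s * chi R e u.
  by rewrite /chi -big_split /=; apply: eq_bigr => x _.
under eq_bigr => s _ do rewrite (reindex_inj (inv_inj (twK s))) /=.
rewrite exchange_big /=; apply: sumr_ge0 => u _.
pose k e := J e * (1 + chi R e u).
have k0 e : e \in w -> 0 <= k e.
  move=> ew; rewrite mulr_ge0 ?hJ ?wE //.
  by case: (chi_pm R e u) => ->; lra.
pose Y := ((X :&: C) :\: [set r]) :|: ([set r] :\: (X :&: C)).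
have -> : \sum_s chi R (X :&: C) s * (spin R (s r) - spin R (tw s u r)) *
    \prod_(e in w) mayer J s (tw s u) e =
  (1 - spin R (u r)) * \sum_s chi R Y s * \prod_(e <- enum w)
    (((expR (k e) + expR (- k e)) / 2 - 1) +
     (expR (k e) - expR (- k e)) / 2 * chi R e s).
  rewrite mulr_sumr; apply: eq_bigr => s _; rewrite -chiM chi1 spin_tw.
  rewrite big_enum /=.
  rewrite (eq_bigr (fun e => expR (k e) * 0 + mayer J s (tw s u) e)); last first.
    by move=> e _; rewrite mulr0 add0r.
  rewrite [in RHS](eq_bigr (fun e => mayer J s (tw s u) e)); last first.
    move=> e _; rewrite /mayer chi_tw.
    have -> : J e * (chi R e s + chi R e s * chi R e u) = k e * chi R e s.
      by rewrite /k; ring.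
    by rewrite (expRM_pm _ (chi_pm R e s)); ring.
  rewrite [in LHS](eq_bigr (fun e => mayer J s (tw s u) e)); last first.
    by move=> e _; rewrite mulr0 add0r.
  by ring.
rewrite mulr_ge0 //; first by case: (u r) => /=; lra.
apply: griffiths1 => e; rewrite mem_enum => ew.
  by rewrite subr_ge0 cosh_ge1.
by apply: sinh_ge0; apply: k0.
Qed.

Lemma cluster_root_in C (w : {set {set V}}) : cluster r w == C -> r \in C.
Proof. by move/eqP <-; exact: cluster_root. Qed.

Lemma mayer_mixl C s s' t t' e : e \in edges_in E C ->
  mayer J (mix C s s') (mix C t t') e = mayer J s t e.
Proof. by rewrite inE /mayer => /andP[_ eC]; rewrite !chi_mixl. Qed.

Lemma inner_sum_mix C p q :
  inner_sum C (mix C p.1 q.1, mix C p.2 q.2) = inner_sum C p.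
Proof.
rewrite /inner_sum /= chi_mixl ?subsetIr // !mulr_sumr.
apply: eq_bigr => w /andP[wC /cluster_root_in rC]; rewrite !ffunE rC.
congr (_ * _); apply: eq_bigr => e /(subsetP wC); exact: mayer_mixl.
Qed.

Lemma outer_sum_mix C S p q : avoids C S ->
  outer_sum C S (mix C p.1 q.1, mix C p.2 q.2) = outer_sum C S q.
Proof.
move=> /forall_inP aS; rewrite /outer_sum /= chi_mixr; last first.
  by rewrite disjoint_sym disjoints_subset; apply/subsetP => x; rewrite !inE => ->.
congr (_ * _ * _).
  by apply: eq_bigr => i /aS /negPf iC; rewrite !ffunE iC.
by apply: eq_bigr => e; rewrite inE /mayer => /andP[_ d]; rewrite !chi_mixr.
Qed.

(** If no insertion of S lies in C, the two factors depend on disjoint sets of spins and decouple.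
    Otherwise a nonzero inner term makes the copies opposite on C, which kills the insertion
    there. *)
Lemma sum_inner_outer C S : \sum_p inner_sum C p * outer_sum C S p =
  if avoids C S then cluster_coef C * \sum_p outer_sum C S p else 0.
Proof.
case: ifP => aS.
  rewrite /cluster_coef -mulrA (@sum_mix _ _
    (fun p q => (mix C p.1 q.1, mix C p.2 q.2))).
  - rewrite mulrA mulVf ?mul1r // pnatr_eq0 -lt0n.
    by apply/card_gt0P; exists ([ffun=> true], [ffun=> true]).
  - by case=> a b [c d] /=; rewrite !mixK.
  - exact: inner_sum_mix.
  - by move=> p q; exact: outer_sum_mix.
apply: big1 => -[s t] _; apply/eqP; rewrite mulf_eq0 /inner_sum /outer_sum /=.
have /forallPn[i] := negbT aS; rewrite negb_imply negbK => /andP[iS iC].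
case: (eqVneq (pair_insertion S s t) 0) => [->|pn0].
  by rewrite mulr0 mul0r eqxx orbT.
apply/orP; left; rewrite mulr_sumr; apply/eqP; apply: big1.
move=> w /andP[wC /eqP cw]; apply/eqP; rewrite mulf_eq0.
case: (eqVneq (\prod_(e in w) mayer J s t e) 0) => [|wn0]; rewrite ?orbT //.
rewrite orbF mulf_eq0; apply/orP; right; apply: contraNT pn0 => sr.
have wE : w \subset E.
  by apply: subset_trans wC _; apply/subsetP => e; rewrite inE => /andP[].
have := cluster_opposite wE sr wn0; rewrite cw => /subsetP/(_ _ iC).
rewrite inE => h; rewrite /pair_insertion (bigD1 i) //= mulf_eq0; apply/orP; left.
by move: h; case: (s _); case: (t _); rewrite //= ?subrr ?addNr.
Qed.

(** Flipping both copies fixes the Mayer factors and multiplies the rest of the inner factor by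
    (-1)^(|X :&: C| + 1). *)
Lemma cluster_coef_even C : ~~ odd #|X :&: C| -> cluster_coef C = 0.
Proof.
move=> ev; suff s0 : \sum_p inner_sum C p = 0 by rewrite /cluster_coef s0 mulr0.
pose fl (p : config * config) := (flip p.1, flip p.2).
have flK : involutive fl by case=> s t; rewrite /fl /= !flipK.
suff e : \sum_p inner_sum C p = - \sum_p inner_sum C p.
  by apply/eqP; rewrite -[_ == 0](mulrn_eq0 _ 2) mulr2n {1}e addNr.
rewrite {1}(reindex_inj (inv_inj flK)) -sumrN; apply: eq_bigr => p _.
rewrite /inner_sum /fl /= chi_flip -signr_odd (negPf ev) expr0 mul1r.
rewrite !ffunE !spinN; set u := (X in _ * X = _); set u' := (X in _ = - (_ * X)).
suff -> : u = u' by ring.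
apply: eq_bigr => w /andP[wC _]; apply: eq_bigr => e /(subsetP wC).
by rewrite inE /mayer => /andP[/hE h _]; rewrite !chi_flip h -signr_odd expr0 !mul1r.
Qed.

(** The derivative of <s_X> in a field at r, multiplied by Z^2. The left side is a sum over pairs of
    s_X (s_r - t_r); its Mayer expansion is sorted by the cluster C of r. *)
Lemma truncated_cluster_expansion :
  zfun J (fun s => chi R X s * spin R (s r)) * zfun J (fun=> 1) -
  zfun J (chi R X) * zfun J (fun s => spin R (s r)) =
  \sum_(C | odd #|X :&: C|) sacst I (cluster_coef C) *
    (rho C (zfun (off C J) (chi R (X :\: C))) *
     rho C (zfun (off C J) (fun=> 1))).
Proof.
apply: setalgP => S; rewrite coefB !coef_zfunM coef_sum -sumrB.
have -> : \sum_(p : config * config)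
   (chi R X p.1 * spin R (p.1 r) * 1 * pair_insertion S p.1 p.2 *
      (ising_weight E J p.1 * ising_weight E J p.2) -
    chi R X p.1 * spin R (p.2 r) * pair_insertion S p.1 p.2 *
      (ising_weight E J p.1 * ising_weight E J p.2)) =
   \sum_C \sum_p inner_sum C p * outer_sum C S p.
  rewrite exchange_big /=; apply: eq_bigr => -[s t] _ /=.
  rewrite ising_weightM (mayer_cluster r edges_neq0).
  rewrite -mulrBl !mulr_sumr; apply: eq_bigr => C _.
  by rewrite /inner_sum /outer_sum /= (chi_split R X C); ring.
rewrite [RHS]big_mkcond /=; apply: eq_bigr => C _.
rewrite sum_inner_outer; case: ifP => aS; last first.
  case: ifP => // _; rewrite coef_cstM coefM big1 ?mulr0 // => T TS.
  rewrite !coef_of; case: ifP => aT; last by rewrite mul0r.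
  case: ifP => aT'; last by rewrite mulr0.
  case/negP: (negbT aS); apply/forall_inP => i iS.
  case: (boolP (i \in T)) => iT; first by move/forall_inP: aT; apply.
  by move/forall_inP: aT'; apply; rewrite inE iT.
case: ifP => [_|/negbT/cluster_coef_even ->]; last by rewrite mul0r.
rewrite coef_cstM; congr (_ * _).
have -> : coef S (rho C (zfun (off C J) (chi R (X :\: C))) *
                  rho C (zfun (off C J) (fun=> 1))) =
   coef S (zfun (off C J) (chi R (X :\: C)) * zfun (off C J) (fun=> 1)).
  rewrite !coefM; apply: eq_bigr => T TS.
  have aT (U : {set I}) : U \subset S -> avoids C U.
    move=> US; apply/forall_inP => i iU.
    by move/forall_inP: aS; apply; apply: subsetP iU.
  by rewrite [coef T (rho _ _)]coef_of [coef (S :\: T) (rho _ _)]coef_of !aT // subsetDl.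
rewrite coef_zfunM; apply: eq_bigr => p _.
by rewrite /outer_sum mayer_off; ring.
Qed.
End KeyIdentity.
End Model.

(** * Sign induction *)

Section Signs.
Variables (R : realFieldType) (I : finType).
Local Notation A := (setalg R I).
Implicit Types (a b : A) (S T : {set I}).

(** With i the imaginary unit, this is i^|S| for even |S| and i^(|S| - 1) for odd |S|. *)
Definition half_sign S : R := (-1) ^+ #|S|./2.

Definition parity p a := forall S, odd #|S| != p -> coef S a = 0.

Lemma card_split S T : T \subset S -> #|S| = (#|T| + #|S :\: T|)%N.
Proof. by move=> TS; rewrite -{1}(cardsID T S) (setIidPr TS). Qed.

Lemma odd_split S T : T \subset S -> odd #|S| = odd #|T| (+) odd #|S :\: T|.
Proof. by move=> /card_split ->; rewrite oddD. Qed.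

Lemma half_sign_split S T : T \subset S -> ~~ odd #|T| ->
  half_sign S = half_sign T * half_sign (S :\: T).
Proof.
move=> TS /negPf ev.
by rewrite /half_sign (card_split TS) halfD ev add0n exprD.
Qed.

Lemma half_signD1_odd S i : i \in S -> odd #|S| -> half_sign S = half_sign (S :\ i).
Proof.
move=> iS; rewrite /half_sign (cardsD1 i S) iS add1n /= => /negPf ev.
by rewrite uphalf_half ev.
Qed.

Lemma half_signD1_even S i : i \in S -> ~~ odd #|S| -> half_sign S = - half_sign (S :\ i).
Proof.
move=> iS; rewrite /half_sign (cardsD1 i S) iS add1n /= negbK => od.
by rewrite uphalf_half od exprS mulN1r.
Qed.

Lemma parityM p q a b : parity p a -> parity q b -> parity (p (+) q) (a * b).
Proof.
move=> pa pb S; rewrite coefM => oS; apply: big1 => T TS.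
case: (eqVneq (odd #|T|) p) => [e|/pa ->]; last by rewrite mul0r.
rewrite pb ?mulr0 //; apply: contra oS => /eqP <-.
by rewrite (odd_split TS) e.
Qed.

Lemma parity_cst x : parity false (sacst I x).
Proof. by move=> S oS; rewrite coef_cst; case: (S =P _) oS => // ->; rewrite cards0. Qed.

Lemma parityD p a b : parity p a -> parity p b -> parity p (a + b).
Proof. by move=> pa pb S oS; rewrite coefD pa // pb // addr0. Qed.

Lemma parityN p a : parity p a -> parity p (- a).
Proof. by move=> pa S oS; rewrite coefN pa // oppr0. Qed.

Lemma parity_inv a : parity false a -> parity false (sainv a).
Proof.
move=> pa; rewrite /sainv -[false]/(false (+) false); apply: parityM.
  exact: parity_cst.
elim/big_ind: _ => [S _|x y|k _]; [exact: coef0|exact: parityD|].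
elim: (k : nat) => [|l IH]; first by rewrite expr0; exact: parity_cst.
rewrite exprS -[false]/(false (+) false); apply: parityM IH.
apply: parityD; first exact: parity_cst.
apply: parityN; rewrite -[false]/(false (+) false); apply: parityM pa.
exact: parity_cst.
Qed.

(* [a] has nonnegative coefficients after the substitution h -> ih (and, for odd
   [p], multiplication by -i), up to order [n]. *)
Definition alternating p n a :=
  forall S, (#|S| <= n)%N -> odd #|S| = p -> 0 <= half_sign S * coef S a.

(** Half-cardinalities add as soon as one part is even, so signs multiply when one factor is an even
    series. *)
Lemma alternatingM p n a b : parity false a -> alternating false n a ->
  alternating p n b -> alternating p n (a * b).
Proof.
move=> pa aa ab S Sn oS; rewrite coefM mulr_sumr; apply: sumr_ge0 => T TS.
case: (boolP (odd #|T|)) => oT; first by rewrite pa ?oT // mul0r mulr0.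
have Tn := leq_trans (subset_leq_card TS) Sn.
have Dn : (#|S :\: T| <= n)%N by apply: leq_trans Sn; rewrite subset_leq_card ?subsetDl.
rewrite (half_sign_split TS oT) mulrACA mulr_ge0 //.
  by apply: aa => //; exact: negbTE.
by apply: ab => //; rewrite -oS (odd_split TS) (negPf oT).
Qed.

Lemma alternating_sum p n (K : Type) (r : seq K) (P : pred K) (F : K -> A) :
  (forall k, P k -> alternating p n (F k)) ->
  alternating p n (\sum_(k <- r | P k) F k).
Proof.
move=> h S Sn oS; rewrite coef_sum mulr_sumr.
by apply: sumr_ge0 => k Pk; apply: h.
Qed.

Lemma alternating_cstM p n x a : 0 <= x -> alternating p n a ->
  alternating p n (sacst I x * a).
Proof. by move=> x0 aa S Sn oS; rewrite coef_cstM mulrCA mulr_ge0 ?aa. Qed.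

Lemma coef0_inv a : coef set0 a != 0 -> coef set0 (sainv a) = (coef set0 a)^-1.
Proof.
move=> a0; have := congr1 (coef set0) (sainvP a0).
rewrite coef0M -sacst1 coef_cst eqxx => h.
by apply: (mulfI a0); rewrite h divff.
Qed.

(** The inverse b satisfies a_0 b_S = - sum over nonempty T of a_T b_(S \ T), and the minus sign
    cancels the sign of a_T. *)
Lemma alternating_inv n a : parity false a -> 0 < coef set0 a ->
  (forall S, S != set0 -> (#|S| <= n)%N -> half_sign S * coef S a <= 0) ->
  alternating false n (sainv a).
Proof.
move=> pa a0 neg S; have [k] := ubnP #|S|; elim: k S => // k IH S Sk Sn oS.
have an0 : coef set0 a != 0 by rewrite gt_eqF.
case: (eqVneq S set0) => [->|S0].
  by rewrite /half_sign cards0 expr0 mul1r coef0_inv // invr_ge0 ltW.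
have := congr1 (coef S) (sainvP an0).
rewrite -sacst1 coef_cst (negPf S0) coefM (bigD1 set0) ?sub0set //= setD0.
move/eqP; rewrite addr_eq0 => /eqP e.
rewrite -(pmulr_rge0 _ a0) mulrCA e mulrN -mulNr mulr_sumr.
apply: sumr_ge0 => T /andP[TS T0].
case: (boolP (odd #|T|)) => oT; first by rewrite pa ?oT // mul0r mulr0.
have DS : (#|S :\: T| < #|S|)%N.
  by rewrite (card_split TS) -[X in (X < _)%N]add0n ltn_add2r card_gt0.
rewrite (half_sign_split TS oT) -mulNr mulrACA mulr_ge0 //.
  by rewrite mulNr oppr_ge0 neg // (leq_trans (subset_leq_card TS)).
apply: IH; first exact: leq_trans DS _.
  exact: leq_trans (ltnW DS) Sn.
by rewrite -oS (odd_split TS) (negPf oT).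
Qed.
End Signs.

(** * The sign rule for the Ising model, order by order in the field *)

Section Induction.
Variables (R : realType) (V I : finType) (j : I -> V) (E : {set {set V}}).
Local Notation config := {ffun V -> bool}.
Local Notation A := (setalg R I).
Implicit Types (s : config) (X C e : {set V}) (S T : {set I}).
Implicit Types (J : {set V} -> R) (f g : config -> R).
Hypothesis hE : forall e, e \in E -> #|e| = 2%N.

Local Notation zf := (zfun j E).
Definition nonneg J := forall e, e \in E -> 0 <= J e.
Definition zone J : A := zf J (fun=> 1).
Definition expval J X : A := zf J (chi R X) * sainv (zone J).
(** For X empty this is Z_{V\C} / Z_V as a series in the field, up to the constant contributed by
    the free spins on C; X inserts s_X into the numerator. *)
Definition ratio J C X : A :=
  rho j C (zf (off C J) (chi R X)) * sainv (zone J).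

Lemma nonneg_off C J : nonneg J -> nonneg (off C J).
Proof. by move=> h e eE; rewrite /off; case: ifP => // _; exact: h. Qed.

Lemma eq_zfun J J' f g : {in E, J =1 J'} -> f =1 g -> zf J f = zf J' g.
Proof.
move=> eJ ef; apply: setalgP => S; rewrite !coef_of; apply: eq_bigr => s _.
rewrite ef /ising_weight; congr (_ * expR _).
by apply: eq_bigr => e eE; rewrite eJ.
Qed.

Lemma zf_chi0 J : zf J (chi R set0) = zone J.
Proof. by apply: eq_zfun => // s; rewrite chi0. Qed.

Lemma zf_spin J r : zf J (fun s => spin R (s r)) = zf J (chi R [set r]).
Proof. by apply: eq_zfun => // s; rewrite chi1. Qed.

Lemma coef0_zone J : 0 < coef set0 (zone J).
Proof.
rewrite coef_of; apply: (@lt_le_trans _ _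
    (\sum_(s : config | s == [ffun=> true]) ising_weight E J s)).
  by rewrite big_pred1_eq expR_gt0.
rewrite big_mkcond /=; apply: ler_sum => s _.
rewrite /insertion big_set0 !mul1r; case: ifP => // _; exact: expR_ge0.
Qed.

Lemma zone_neq0 J : coef set0 (zone J) != 0.
Proof. by rewrite gt_eqF ?coef0_zone. Qed.

Lemma expvalM J X : expval J X * zone J = zf J (chi R X).
Proof. by rewrite -mulrA (mulrC (sainv _)) sainvP ?zone_neq0 // mulr1. Qed.

Lemma ratioM J C X : ratio J C X * zone J = rho j C (zf (off C J) (chi R X)).
Proof. by rewrite -mulrA (mulrC (sainv _)) sainvP ?zone_neq0 // mulr1. Qed.

Lemma ratio0M J C : ratio J C set0 * zone J = rho j C (zone (off C J)).
Proof. by rewrite ratioM zf_chi0. Qed.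

Lemma sader_zfun i J f :
  sader i (zf J f) = theta R i * zf J (fun s => f s * spin R (s (j i))).
Proof.
apply: setalgP => S; rewrite coef_sader coef_thetaM; case: ifP => // iS.
rewrite !coef_of; apply: eq_bigr => s _.
by rewrite /insertion (bigD1 i iS) /= !mulrA; congr (_ * _ * _);
  apply: eq_bigl => k; rewrite !inE andbC.
Qed.

Lemma sader_zone i J :
  sader i (zone J) = theta R i * expval J [set j i] * zone J.
Proof.
rewrite sader_zfun -mulrA expvalM -zf_spin; congr (_ * _).
by apply: eq_zfun => // s; rewrite mul1r.
Qed.

Lemma avoidsU C S T : avoids j C (S :|: T) = avoids j C S && avoids j C T.
Proof.
apply/forall_inP/andP => [h|[/forall_inP hS /forall_inP hT] i].
  by split; apply/forall_inP => i iS; apply: h; rewrite inE iS ?orbT.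
by rewrite inE => /orP[/hS|/hT].
Qed.

Lemma coef_rho C S (a : A) :
  coef S (rho j C a) = if avoids j C S then coef S a else 0.
Proof. exact: coef_of. Qed.

(** [rho j C] is the substitution h_i = 0 for all i with j i in C, hence multiplicative. *)
Lemma rhoM C (a b : A) : rho j C (a * b) = rho j C a * rho j C b.
Proof.
apply: setalgP => S; rewrite coef_rho !coefM; case: ifP => aS.
  apply: eq_bigr => T TS; rewrite !coef_rho.
  move: aS; rewrite -(setID S T) (setIidPr TS) avoidsU => /andP[-> aD].
  by rewrite setDUl setDv set0U setDDl setUid aD.
symmetry; apply: big1 => T TS; rewrite !coef_rho.
case: ifP => aT; last by rewrite mul0r.
case: ifP => aD; last by rewrite mulr0.
by move: aS; rewrite -(setID S T) (setIidPr TS) avoidsU aT aD.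
Qed.

Lemma sader_rho i C (a : A) : sader i (rho j C a) = rho j C (sader i a).
Proof.
by apply: setalgP => S; rewrite !(coef_sader, coef_rho); do 2!case: ifP.
Qed.

Lemma rho_theta i C :
  rho j C (theta R i) = if j i \in C then 0 else theta R i.
Proof.
apply: setalgP => S; rewrite coef_rho !coef_of; case: (S =P [set i]) => [->|Si].
  have -> : avoids j C [set i] = (j i \notin C).
    apply/forall_inP/idP => [->//|h k]; first by rewrite inE.
    by rewrite inE => /eqP ->.
  by case: (j i \in C) => /=; [rewrite coef0|rewrite coef_of eqxx].
by rewrite if_same; case: ifP => _; [rewrite coef0|rewrite coef_of; case: eqP].
Qed.

Lemma ratio_split J C X :
  ratio J C X = rho j C (expval (off C J) X) * ratio J C set0.
Proof. by rewrite /ratio mulrA -rhoM zf_chi0 expvalM. Qed.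

(** Minus the logarithmic derivative of Z_{V\C} / Z_V in h_i: the change of <s_(j i)> when C is
    removed. For j i in C the numerator does not depend on h_i. *)
Definition gap J C i : A :=
  expval J [set j i] -
  (if j i \in C then 0 else rho j C (expval (off C J) [set j i])).

Lemma sader_ratio i J C :
  sader i (ratio J C set0) = - (theta R i * (ratio J C set0 * gap J C i)).
Proof.
apply: (@saregI _ _ (zone J)); first exact: zone_neq0.
have := congr1 (sader i) (ratio0M J C).
rewrite saderM sader_zone sader_rho sader_zone
  (rhoM _ _ (zone _)) (rhoM _ (theta R i)) rho_theta -ratio0M => h.
apply: (@addIr _ (ratio J C set0 * (theta R i * expval J [set j i] * zone J))).
by rewrite mulrC h /gap; case: (j i \in C); ring.
Qed.

(** The quotient rule produces the truncated correlation; its cluster expansion divided by Z^2 gives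
    the ratios. *)
Lemma sader_expval i J X : nonneg J -> exists a : {set V} -> R,
  (forall C, 0 <= a C) /\
  sader i (expval J X) = theta R i * \sum_(C | odd #|X :&: C|)
    sacst I (a C) * (ratio J C (X :\: C) * ratio J C set0).
Proof.
move=> hJ; exists (cluster_coef E J (j i) X); split.
  by move=> C; exact: cluster_coef_ge0.
apply: (@saregI _ _ (zone J * zone J)).
  by rewrite coef0M mulf_neq0 ?zone_neq0.
have h := congr1 (sader i) (expvalM J X).
move: h; rewrite saderM sader_zone sader_zfun => h.
have := truncated_cluster_expansion j hE J (j i) X.
rewrite -/(zone J) zf_spin -!expvalM => k.
have -> : zone J * zone J * sader i (expval J X) = theta R i *
   (zf J (fun s => chi R X s * spin R (s (j i))) * zone J -
    expval J X * zone J * (expval J [set j i] * zone J)).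
  by rewrite mulrBr (mulrA (theta R i) (zf _ _)) -h; ring.
rewrite k mulrCA; congr (_ * _); rewrite mulr_sumr; apply: eq_bigr => C _.
by rewrite -ratioM -/(zone (off C J)) -ratio0M; ring.
Qed.

Lemma weight_flip J s : ising_weight E J (flip s) = ising_weight E J s.
Proof.
rewrite /ising_weight; congr expR; apply: eq_bigr => e eE.
by have := chi_flip R e s; rewrite /chi (hE eE) sqrrN expr1n mul1r => ->.
Qed.

Lemma insertion_flip S s :
  insertion R j S (flip s) = (-1) ^+ #|S| * insertion R j S s.
Proof.
rewrite /insertion -prodr_const -big_split /=; apply: eq_bigr => x _.
by rewrite ffunE spinN mulN1r.
Qed.

Lemma parity_zfun J X : parity (odd #|X|) (zf J (chi R X)).
Proof.
move=> S oS; rewrite coef_of; set u := \sum_s _.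
suff e : u = - u by apply/eqP; rewrite -[_ == 0](mulrn_eq0 _ 2) mulr2n {1}e addNr.
rewrite {1}/u (reindex_inj (inv_inj (@flipK V))) -sumrN; apply: eq_bigr => s _.
rewrite weight_flip chi_flip insertion_flip mulrACA -exprD -signr_odd oddD.
by move: oS; rewrite addbC -negb_eqb => ->; rewrite expr1 !mulN1r mulNr.
Qed.

Lemma parity_zone J : parity false (zone J).
Proof. by have := @parity_zfun J set0; rewrite cards0 zf_chi0. Qed.

Lemma parity_expval J X : parity (odd #|X|) (expval J X).
Proof.
rewrite -[odd _]addbF; apply: parityM; first exact: parity_zfun.
exact: parity_inv (parity_zone _).
Qed.

Lemma parity_rho C p (a : A) : parity p a -> parity p (rho j C a).
Proof. by move=> pa S oS; rewrite coef_rho pa // if_same. Qed.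

Lemma parity_ratio0 J C : parity false (ratio J C set0).
Proof.
rewrite -[false]/(false (+) false); apply: parityM.
  by apply: parity_rho; rewrite zf_chi0; exact: parity_zone.
exact: parity_inv (parity_zone _).
Qed.

Lemma alternating_rho p n C (a : A) :
  alternating p n a -> alternating p n (rho j C a).
Proof.
move=> aa S Sn oS; rewrite coef_rho; case: ifP => _; last by rewrite mulr0.
exact: aa.
Qed.

Lemma weight_Jupd J e (t : R) s : e \in E ->
  let d := t - J e in
  ising_weight E (Jupd J e t) s = ising_weight E J s *
    ((expR d + expR (- d)) / 2 + (expR d - expR (- d)) / 2 * chi R e s).
Proof.
move=> eE d; rewrite -(expRM_pm _ (chi_pm R e s)) /ising_weight -expRD; congr expR.
rewrite (bigD1 e eE) [in RHS](bigD1 e eE) /= /Jupd eqxx.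
rewrite (eq_bigr (fun e' => J e' * chi R e' s)) => [|e' /andP[_ /negPf ->] //].
by rewrite /d /chi; ring.
Qed.

Definition edge_negative n J := forall e S, e \in E -> S != set0 ->
  (#|S| <= n)%N -> half_sign R S * coef S (expval J e) <= 0.

(** The logarithmic derivative of z q exceeds that of z by that of q, with denominators cleared; c d
    is the derivative of q. *)
Lemma divide_derivation (B : comNzRingType) (z q q' c d x y th : B) :
  th * x * z * q + z * (c * d) = th * y * (z * q) -> q * q' = 1 ->
  z * q * (th * (y - x)) = z * q * (c * (q' * d)).
Proof.
move=> h hq; have -> : z * q * (c * (q' * d)) = (q * q') * (z * (c * d)) by ring.
have -> : z * q * (th * (y - x)) = th * y * (z * q) - th * x * z * q by ring.
by rewrite -h hq; ring.
Qed.

(** Here Z_J' = Z_J Q with Q = cosh d + sinh d <s_e>_J, so the increase of <s_(j i)> is the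
    logarithmic derivative of Q in h_i. The sign rule for <s_e> controls both the inverse of Q and
    its derivative. *)
Lemma expval_Jupd_ge n J e (t : R) i S : e \in E -> J e <= t -> edge_negative n J ->
  i \notin S -> (#|S| < n)%N -> odd #|S| ->
  half_sign R S * coef S (expval J [set j i]) <=
  half_sign R S * coef S (expval (Jupd J e t) [set j i]).
Proof.
move=> eE Jt neg iS Sn oS; set J' := Jupd J e t.
have wJ' := weight_Jupd J t ^~ eE; cbv zeta in wJ'.
set d := t - J e in wJ'; set c := (expR d + expR (- d)) / 2 in wJ'.
set q := (expR d - expR (- d)) / 2 in wJ'.
have q0 : 0 <= q by apply: sinh_ge0; rewrite subr_ge0.
pose Q : A := sacst I c + sacst I q * expval J e.
have zJ' : zone J' = zone J * Q.
  rewrite mulrDr mulrCA (mulrC (zone J)) (mulrC (zone J) (expval _ _)) expvalM.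
  apply: setalgP => T; rewrite coefD !coef_cstM !coef_of !mulr_sumr -big_split /=.
  by apply: eq_bigr => s _; rewrite wJ'; ring.
have Q0 : 0 < coef set0 Q.
  by rewrite -(pmulr_rgt0 _ (coef0_zone J)) -coef0M -zJ' coef0_zone.
have pQ : parity false Q.
  apply: parityD; first exact: parity_cst.
  rewrite -[false]/(false (+) false); apply: parityM; first exact: parity_cst.
  by have := @parity_expval J e; rewrite hE.
have aQ : alternating false n (sainv Q).
  apply: alternating_inv => // T T0 Tn.
  rewrite coefD coef_cst (negPf T0) add0r coef_cstM mulrCA.
  by rewrite mulr_ge0_le0 // neg.
have key : theta R i * (expval J' [set j i] - expval J [set j i]) =
    sacst I q * (sainv Q * sader i (expval J e)).
  have dQ : sader i Q = sacst I q * sader i (expval J e).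
    by rewrite saderD sader_cst saderM sader_cst mul0r !add0r.
  have dz := sader_zone i J'; rewrite zJ' saderM sader_zone dQ in dz.
  apply: (@saregI _ _ (zone J')); first exact: zone_neq0.
  rewrite zJ'; clearbody Q J'.
  exact: divide_derivation dz (sainvP (lt0r_neq0 Q0)).
have iS' : i \in i |: S by rewrite setU11.
have oS' : ~~ odd #|i |: S| by rewrite cardsU1 iS add1n /= oS.
have Sn' : (#|i |: S| <= n)%N by rewrite cardsU1 iS add1n.
rewrite -subr_ge0 -mulrBr -coefB.
have := congr1 (coef (i |: S)) key.
rewrite coef_thetaM iS' setU1K // => ->.
(* Passing from the odd set S to the even set i |: S reverses the sign, which turns nonpositive edge
   coefficients into an increase. *)
rewrite -[half_sign R S]opprK -{1}(setU1K iS) -(half_signD1_even R iS' oS').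
rewrite coef_cstM mulrCA mulr_ge0 // mulNr -mulrN -coefN -mulrN.
apply: (alternatingM (parity_inv pQ) aQ) => //.
move=> T Tn oT; rewrite coefN coef_sader; case: ifP => iT.
  rewrite mulrN oppr_ge0 neg //.
  by apply: contraTneq iT => ->; rewrite inE.
by rewrite oppr0 mulr0.
Qed.

Lemma expval_mono n J J' i S : (forall J, nonneg J -> edge_negative n J) ->
  nonneg J -> (forall e, e \in E -> J e <= J' e) ->
  i \notin S -> (#|S| < n)%N -> odd #|S| ->
  half_sign R S * coef S (expval J [set j i]) <=
  half_sign R S * coef S (expval J' [set j i]).
Proof.
move=> neg J0 JJ' iS Sn oS.
(* The couplings are raised one edge at a time; L lists the edges already raised. *)
pose hyb (L : seq {set V}) e := if e \in L then J' e else J e.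
have ev J1 J2 : {in E, J1 =1 J2} -> expval J1 [set j i] = expval J2 [set j i].
  by move=> h; rewrite /expval /zone !(eq_zfun h (fun=> erefl)).
have -> : expval J' [set j i] = expval (hyb (enum E)) [set j i].
  by apply: ev => e eE; rewrite /hyb mem_enum eE.
have : {subset enum E <= E} by move=> e; rewrite mem_enum.
elim: (enum E) => [|e L IH] LE; first by rewrite (ev (hyb [::]) J).
have LE' : {subset L <= E} by move=> e' h; apply: LE; rewrite inE h orbT.
apply: (le_trans (IH LE')).
have -> : expval (hyb (e :: L)) [set j i] =
    expval (Jupd (hyb L) e (J' e)) [set j i].
  by apply: ev => e' _; rewrite /hyb /Jupd inE; case: eqP => // ->.
apply: (@expval_Jupd_ge n) => //; first by apply: LE; rewrite mem_head.
  rewrite /hyb; case: ifP => // _; apply: JJ'; apply: LE; exact: mem_head.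
apply: neg => e' eE; rewrite /hyb; case: ifP => _; last exact: J0.
exact: le_trans (J0 _ eE) (JJ' _ eE).
Qed.

Definition spin_positive n J := forall v, alternating true n (expval J [set v]).
Definition ratio_positive n J := forall C, alternating false n (ratio J C set0).

(** For X = {v} only clusters containing v contribute, leaving nonnegative multiples of squares of
    Z_{V\C} / Z_V. The factor h_i raises the order by one. *)
Lemma spin_positiveS n J : nonneg J -> ratio_positive n J ->
  spin_positive n.+1 J.
Proof.
move=> J0 rp v S Sn oS.
have /card_gt0P[i iS] : (0 < #|S|)%N by rewrite lt0n; apply: contraTneq oS => ->.
have [a [a0 e]] := sader_expval i [set v] J0.
have := congr1 (coef S) e; rewrite coef_sader coef_thetaM iS => ->.
rewrite (half_signD1_odd R iS oS).
apply: (@alternating_sum _ _ false n) => [C vC||].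
- apply: alternating_cstM => //.
  have -> : [set v] :\: C = set0.
    apply/eqP; rewrite setD_eq0 sub1set; apply: contraTT vC => vC.
    rewrite (_ : _ :&: _ = set0) ?cards0 //.
    by apply/eqP; rewrite setI_eq0 disjoints1.
  by apply: alternatingM (rp C) (rp C); exact: parity_ratio0.
- by move: Sn; rewrite (cardsD1 i) iS.
- by move: oS; rewrite (cardsD1 i) iS /= => /negbTE.
Qed.

(** A cluster meeting the edge e in an odd number of vertices contains exactly one end; the other
    end v is left as <s_v>_{V\C}. The step from odd to even order gives the minus sign. *)
Lemma edge_negativeS n J : nonneg J -> ratio_positive n J ->
  (forall C, spin_positive n (off C J)) -> edge_negative n.+1 J.
Proof.
move=> J0 rp sp e S eE S0 Sn.
case: (boolP (odd #|S|)) => oS.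
  have /(_ S) -> := @parity_expval J e; first by rewrite mulr0.
  by rewrite oS hE.
case/set0Pn: S0 => i iS.
have [a [a0 h]] := sader_expval i e J0.
have := congr1 (coef S) h; rewrite coef_sader coef_thetaM iS => ->.
rewrite (half_signD1_even R iS oS) mulNr oppr_le0.
apply: (@alternating_sum _ _ true n) => [C||].
- move=> oC; apply: alternating_cstM => //.
  have /cards1P[v ->] : #|e :\: C| == 1%N.
    have := hE eE; rewrite -(cardsID C e).
    by move: oC; case: #|e :&: C| => [//|[|[|m]]] //= _; rewrite add1n => -[->].
  rewrite ratio_split //.
  rewrite mulrC (mulrC (rho _ _ _)).
  apply: alternatingM (rp C) _; first exact: parity_ratio0.
  apply: alternatingM (rp C) _; first exact: parity_ratio0.
  by apply: alternating_rho; exact: sp.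
- by move: Sn; rewrite (cardsD1 i) iS.
- by move: oS; rewrite (cardsD1 i) iS /= negbK.
Qed.

(** The derivative of the ratio is minus the ratio times [gap], and this minus cancels the sign
    change between S and S :\ i. The gap has the right sign by monotonicity in J, since deleting C
    lowers couplings to 0. *)
Lemma ratio_positiveS n J : nonneg J ->
  (forall J, nonneg J -> edge_negative n.+1 J) -> spin_positive n J ->
  ratio_positive n J -> ratio_positive n.+1 J.
Proof.
move=> J0 neg sp rp C S Sn oS.
case: (set_0Vmem S) => [->|[i iS]].
  rewrite /half_sign cards0 expr0 mul1r coef0M coef0_inv ?zone_neq0 //.
  rewrite mulr_ge0 ?invr_ge0 ?(ltW (coef0_zone _)) //.
  rewrite coef_rho zf_chi0; case: ifP => // _; exact: ltW (coef0_zone _).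
have := congr1 (coef S) (sader_ratio i J C).
rewrite coef_sader coefN coef_thetaM iS => ->.
rewrite (half_signD1_even R iS) ?oS // mulrNN coefM mulr_sumr.
have oSi : odd #|S :\ i| by move: oS; rewrite (cardsD1 i) iS /= => /negbFE.
have Sin : (#|S :\ i| <= n)%N by move: Sn; rewrite (cardsD1 i) iS.
apply: sumr_ge0 => T TS.
case: (boolP (odd #|T|)) => oT.
  have /(_ T) -> := @parity_ratio0 J C; last by rewrite oT.
  by rewrite mul0r mulr0.
rewrite (half_sign_split R TS oT) mulrACA mulr_ge0 //.
  apply: rp; last exact: negbTE.
  exact: leq_trans (subset_leq_card TS) Sin.
set D := (S :\ i) :\: T.
have Dn : (#|D| <= n)%N by apply: leq_trans Sin; rewrite subset_leq_card ?subsetDl.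
have oD : odd #|D| by move: oSi; rewrite (odd_split TS) (negPf oT).
have iD : i \notin D by rewrite !inE eqxx andbF.
rewrite /gap coefB mulrBr subr_ge0.
have spD : 0 <= half_sign R D * coef D (expval J [set j i]) by exact: sp.
case: ifP => iC; first by rewrite coef0 mulr0.
rewrite coef_rho; case: ifP => _; last by rewrite mulr0.
apply: (@expval_mono n.+1) => //; first exact: nonneg_off.
by move=> e eE; rewrite /off; case: ifP => // _; exact: J0.
Qed.

(** The couplings J stay general in the induction: order n + 1 at J uses order n at [off C J], and
    comparing J with [off C J] passes through intermediate couplings. *)
Lemma sign_induction n J : nonneg J ->
  [/\ edge_negative n J, spin_positive n J & ratio_positive n J].
Proof.
elim: n J => [|n IH] J J0.
  split.
  - by move=> e S _ S0; rewrite leqn0 cards_eq0 (negPf S0).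
  - by move=> v S; rewrite leqn0 cards_eq0 => /eqP ->; rewrite cards0.
  move=> C S; rewrite leqn0 cards_eq0 => /eqP -> _.
  rewrite /half_sign cards0 expr0 mul1r coef0M coef0_inv ?zone_neq0 //.
  rewrite mulr_ge0 ?invr_ge0 ?(ltW (coef0_zone _)) //.
  rewrite coef_rho zf_chi0; case: ifP => // _; exact: ltW (coef0_zone _).
have neg J1 : nonneg J1 -> edge_negative n.+1 J1.
  move=> J10; have [_ _ rp] := IH J1 J10; apply: edge_negativeS => // C.
  by have [] := IH _ (nonneg_off C J10).
have [_ sp rp] := IH J J0; split; first exact: neg.
  exact: spin_positiveS.
exact: ratio_positiveS.
Qed.

(** The cumulants are the coefficients of ln Z, whose derivative in h_i is <s_(j i)>. The logarithm
    itself is avoided: the moment-cumulant recursion says that [sader i u] times Z is [sader i] of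
    Z. *)
Lemma coef_setT_cumulant J i :
  cumulant (fun S => ising_expect E J (insertion R j S)) [set: I] =
  coef ([set: I] :\ i) (expval J [set j i]).
Proof.
set m := fun S => _.
have Z0 : ising_Z E J = coef set0 (zone J).
  rewrite coef_of; apply: eq_bigr => s _.
  by rewrite /insertion big_set0 !mul1r.
have mE S : m S = (ising_Z E J)^-1 * coef S (zone J).
  rewrite /m /ising_expect mulrC coef_of; congr (_ * _).
  by apply: eq_bigr => s _; rewrite mul1r.
have m0 : m set0 = 1 by rewrite mE Z0 mulVf ?zone_neq0.
pose u : A := setalg_of (cumulant m).
suff e : sader i u = theta R i * expval J [set j i].
  have := congr1 (coef [set: I]) e; rewrite coef_sader coef_thetaM inE => <-.
  by rewrite coef_of.
apply: (@saregI _ _ (zone J)); first exact: zone_neq0.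
rewrite [RHS]mulrC -sader_zone; apply: setalgP => S.
rewrite coefM coef_sader; case: ifP => iS; last first.
  apply: big1 => T TS; rewrite coef_sader inE iS andbF mulr0 //.
have Zn : ising_Z E J != 0 by rewrite Z0 zone_neq0.
have -> : coef S (zone J) = ising_Z E J * m S by rewrite mE mulrA divff ?mul1r.
rewrite (moment_cumulant m0 iS) mulr_sumr [LHS](bigID (fun T => i \notin T)) /=.
rewrite [X in _ + X]big1 ?addr0.
  apply: eq_bigr => T /andP[TS iT]; rewrite coef_sader inE iS iT /= [coef _ u]coef_of.
  by rewrite mE mulrA mulrA divff ?mul1r.
by move=> T /andP[_ /negbNE iT]; rewrite coef_sader inE iT mulr0.
Qed.
End Induction.


(** * From monotonicity to the sign of a derivative *)

Section Derivative.
Import numFieldNormedType.Exports.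
Local Open Scope classical_set_scope.

Lemma signed_derive1_ge0 (R : realType) (f : R -> R) (a : R) (n : nat) :
  (forall t, a <= t -> (-1) ^+ n * f a <= (-1) ^+ n * f t) ->
  0 <= (-1) ^+ n * derive1 f a.
Proof.
move=> mono; rewrite /derive1.
set F := (fun h => h^-1 *: (f (h + a) - f a)).
have [cF|dF] := pselect (cvg (F @ 0^')); last first.
  (* Without a limit of the difference quotients, [derive1] has the default value 0. *)
  by rewrite (dvgP dF) mulr0.
(* The comparison covers only t >= a, so the limit is evaluated from the right. *)
have cF' : cvg (F @ 0^'+).
  by apply: (cvgP (lim (F @ 0^'))); exact: cvg_dnbhs_at_right.
have F0 h : 0 < h -> 0 <= (-1) ^+ n * F h.
  move=> h0; rewrite /F -[_ *: _]/(_ * _) mulrCA mulr_ge0 ?invr_ge0 ?(ltW h0) //.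
  by rewrite mulrBr subr_ge0 mono // lerDr ltW.
rewrite (@cvg_at_rightE _ _ F 0 cF); move: F0; rewrite -signr_odd; case: (odd n) => F0.
  rewrite mulN1r oppr_ge0; apply: limr_le => //.
  near=> h; rewrite -oppr_ge0 -mulN1r; apply: F0; near: h; exact: nbhs_right_gt.
rewrite mul1r; apply: limr_ge => //.
near=> h; rewrite -[F h]mul1r; apply: F0; near: h; exact: nbhs_right_gt.
Unshelve. all: by end_near.
Qed.
End Derivative.

(** * Sign of the coupling derivative of the Ursell functions *)

Unset Implicit Arguments. Set Strict Implicit. Set Printing Implicit Defensive.

Theorem mainTheorem1 (R : realType) (V : finType) (E : {set {set V}})
  (J : {set V} -> R)
  (hE : forall e, e \in E -> #|e| = 2%N)
  (hJ : forall e, e \in E -> 0 <= J e)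
  (k : nat) (hk : (0 < k)%N) (j : 'I_(2 * k) -> V)
  (e0 : {set V}) (he0 : e0 \in E) :
  0 <= (-1) ^+ (k.-1) *
       derive1 (fun t : R => ursell E (Jupd J e0 t) j) (J e0).
Proof.
apply: signed_derive1_ge0 => t Jt.
have k2 : (0 < 2 * k)%N by rewrite muln_gt0.
(* Any index could be singled out; 0 exists because k > 0. The remaining set S has odd cardinality
   2k - 1. *)
pose i := Ordinal k2; pose S := [set: 'I_(2 * k)] :\ i.
have S1 : #|S|.+1 = (2 * k)%N.
  by have := cardsD1 i [set: 'I_(2 * k)]; rewrite inE cardsT card_ord => /esym.
have uE J' : ursell E J' j = coef S (expval j E J' [set j i]).
  exact: (coef_setT_cumulant j E J' i).
(* The sign in the statement is that of S, because (2k - 1)./2 = k - 1. *)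
have sE : (-1) ^+ k.-1 = half_sign R S.
  have half m n : (m.+1 = 2 * n)%N -> n.-1 = m./2.
    by case: n => // n; rewrite mul2n doubleS => -[->]; rewrite /= uphalf_double.
  by rewrite (half _ _ S1).
have oS : odd #|S| by have := congr1 odd S1; rewrite oddM /= => /negbFE.
have -> : Jupd J e0 (J e0) = J.
  by apply/funext => e; rewrite /Jupd; case: eqP => [->|].
rewrite !uE sE; apply: (@expval_Jupd_ge _ _ _ _ _ hE (2 * k)) => //.
- by have [] := sign_induction j hE (2 * k) hJ.
- by rewrite !inE eqxx.
- by rewrite S1.
Qed.
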